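(* Let $A\in\mathbb{R}^{n\times m}$ be the optimizer's utility matrix of a zero-sum game satisfying the following assumption: there exists a minmax strategy $x\in\Delta(\mathcal{A})$ of the optimizer such that there exist two best responses $b_{i_1},b_{i_2}\in\mathrm{BR}(x)$ of the learner which do not coincide on $\mathrm{support}(x)$, namely, there exists an action $a_k\in\mathrm{support}(x)$ such that $a_k^\top Ab_{i_1}\neq a_k^\top Ab_{i_2}$. Then for any $\eta\in(0,1)$ and any $T\in\mathbb{N}$ there exists an optimizer (a strategy $x(1),\dots,x(T)\in\Delta(\mathcal{A})$) which, against a learner that uses MWU with step size $\eta$, achieves a utility of at least $$T\,\mathrm{Val}(A)+\Omega(\eta T),$$ where the constant in $\Omega(\cdot)$ possibly depends on $A$; that is, at least $T\,\mathrm{Val}(A)+C_A\,\eta\,T$ for a constant $C_A>0$ that depends only on $A$.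
   Context: The optimizer's pure actions $a_1,\dots,a_n$ are identified with the standard basis of $\mathbb{R}^n$ and the learner's pure actions $b_1,\dots,b_m$ with the standard basis of $\mathbb{R}^m$; $\Delta(\mathcal{A})$, $\Delta(\mathcal{B})$ are the corresponding probability simplices. $\mathrm{Val}(A)=\max_{x\in\Delta(\mathcal{A})}\min_{y\in\Delta(\mathcal{B})}x^\top Ay$. A minmax strategy of the optimizer is $x\in\Delta(\mathcal{A})$ with $\min_{i}x^\top Ab_i=\mathrm{Val}(A)$. $\mathrm{BR}(x)=\arg\min_{b\in\{b_1,\dots,b_m\}}x^\top Ab$ is the set of the learner's pure best responses (the learner's utility matrix is $-A$), and $\mathrm{support}(x)$ is the set of pure actions $a_k$ with $x_k>0$. The learner using MWU (Multiplicative Weights Update) with step size $\eta$ plays in round $t$ the mixed strategy $y_i(t)=\exp(-\eta\sum_{s=1}^{t-1}x(s)^\top Ab_i)\big/\sum_{j=1}^m\exp(-\eta\sum_{s=1}^{t-1}x(s)^\top Ab_j)$, $i=1,\dots,m$. The optimizer's total utility is $\sum_{t=1}^T x(t)^\top A\,y(t)$.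
   Formalization: The case T = 1 is excluded: the bound fails there for matching pennies, where MWU plays uniformly in round 1 and every x(1) earns exactly Val(A) = 0; the bound is proved for all other T. *)

(* Defs.v *)
From HB Require Import structures.
From mathcomp Require Import all_boot all_order all_algebra.
From mathcomp Require Import all_classical all_reals all_analysis.
Set Implicit Arguments.
Unset Strict Implicit.
Unset Printing Implicit Defensive.
Import Order.TTheory GRing.Theory Num.Theory.
Local Open Scope classical_set_scope.
Local Open Scope ring_scope.

Definition simplex (R : realType) (k : nat) : set 'cV[R]_k :=
  [set x | (forall i, 0 <= x i 0) /\ \sum_(i < k) x i 0 = 1].
Arguments simplex R k : clear implicits.

Definition pure (R : realType) (k : nat) (i : 'I_k) : 'cV[R]_k := delta_mx i 0.

Definition payoff (R : realType) (n m : nat) (A : 'M[R]_(n, m))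
    (x : 'cV[R]_n) (y : 'cV[R]_m) : R :=
  (x^T *m A *m y) 0 0.

(* [sup] and [inf] stand for max and min: for nonempty action sets both are
   attained, the simplices being compact and the payoff continuous. *)
Definition Val (R : realType) (n m : nat) (A : 'M[R]_(n, m)) : R :=
  sup [set inf [set payoff A x y | y in simplex R m] | x in simplex R n].

(* The minimum over the finite set of pure responses, again written [inf]. *)
Definition minmax_strategy (R : realType) (n m : nat) (A : 'M[R]_(n, m))
    (x : 'cV[R]_n) : Prop :=
  simplex R n x /\ inf [set payoff A x (pure R i) | i in [set: 'I_m]] = Val A.

Definition BR (R : realType) (n m : nat) (A : 'M[R]_(n, m)) (x : 'cV[R]_n) :
    set 'I_m :=
  [set i | forall j, payoff A x (pure R i) <= payoff A x (pure R j)].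

Definition support (R : realType) (n : nat) (x : 'cV[R]_n) : set 'I_n :=
  [set k | 0 < x k 0].

Definition non_coinciding_best_responses (R : realType) (n m : nat)
    (A : 'M[R]_(n, m)) : Prop :=
  exists x : 'cV[R]_n, minmax_strategy A x /\
    exists i1 i2 : 'I_m, BR A x i1 /\ BR A x i2 /\
      exists k : 'I_n, support x k /\
        payoff A (pure R k) (pure R i1) <> payoff A (pure R k) (pure R i2).

(* Rounds are numbered from 1, so [x 0] is never read. *)
Definition mwu_weight (R : realType) (n m : nat) (A : 'M[R]_(n, m)) (eta : R)
    (x : nat -> 'cV[R]_n) (t : nat) (i : 'I_m) : R :=
  expR (- (eta * \sum_(1 <= s < t) payoff A (x s) (pure R i))).

Definition mwu (R : realType) (n m : nat) (A : 'M[R]_(n, m)) (eta : R)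
    (x : nat -> 'cV[R]_n) (t : nat) : 'cV[R]_m :=
  \col_(i < m) (mwu_weight A eta x t i / \sum_(j < m) mwu_weight A eta x t j).

Definition total_utility (R : realType) (n m : nat) (A : 'M[R]_(n, m)) (eta : R)
    (x : nat -> 'cV[R]_n) (T : nat) : R :=
  \sum_(1 <= t < T.+1) payoff A (x t) (mwu A eta x t).

(* Main.v *)
(** Write [u = x^T A] for the given minmax strategy [x], and [v = Val A], so
    that [u >= v] with equality on best responses.  The optimizer alternates
    between [x + d] and [x - d], where [d] is a small multiple of [a_k - x];
    put [w = d^T A].  Before each pair of rounds the learner has only seen
    multiples of [u], so the best responses [i1], [i2] carry maximal weight.
    In a pair the optimizer gains the difference of the means of [w] under the
    weights [p] of the first round and [r = p exp (- eta (u - v + w))] of the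
    second.  Passing from [p] to [q = p exp (- eta (u - v))] costs at most the
    mean of [u - v] under [p], which the first round already earned because the
    learner then plays non-best responses; passing from [q] to
    [r = q exp (- eta w)] earns order [eta], by Chebyshev's rearrangement and
    [w i1 <> w i2]. *)
Require Import Defs.
From HB Require Import structures.
From mathcomp Require Import all_boot all_order all_algebra.
From mathcomp Require Import all_classical all_reals all_analysis.
From mathcomp Require Import ring lra zify.
Set Implicit Arguments.
Unset Strict Implicit.
Unset Printing Implicit Defensive.
Import Order.TTheory GRing.Theory Num.Theory.
Local Open Scope classical_set_scope.
Local Open Scope ring_scope.

(** * Means under unnormalized weights, and how they react to reweighting *)

Definition avg (R : realType) (I : finType) (p f : I -> R) : R :=
  (\sum_i p i * f i) / \sum_i p i.

Section WeightedMean.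
Context {R : realType} {I : finType}.
Implicit Types (p q f g : I -> R) (c eta : R).

Lemma sum_weight_gt0 p (i0 : I) : (forall i, 0 < p i) -> 0 < \sum_i p i.
Proof.
move=> p0; rewrite (bigD1 i0) //=; apply: ltr_pwDl => //.
by apply: sumr_ge0 => i _; exact: ltW.
Qed.

Lemma avgZ p f c : c != 0 -> avg (fun i => c * p i) f = avg p f.
Proof.
move=> c0; rewrite /avg.
under eq_bigr do rewrite -mulrA.
by rewrite -!mulr_sumr invfM mulrACA divff // mul1r.
Qed.

Lemma eq_avg p q f g : p =1 q -> f =1 g -> avg p f = avg q g.
Proof.
move=> pq fg; rewrite /avg (eq_bigr _ (fun i _ => pq i)).
by congr (_ / _); apply: eq_bigr => i _; rewrite pq fg.
Qed.

Lemma avgD p f g : avg p (f \+ g) = avg p f + avg p g.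
Proof.
rewrite /avg -mulrDl -big_split /=; congr (_ / _).
by apply: eq_bigr => i _; rewrite mulrDr.
Qed.

Lemma avgN p f : avg p (fun i => - f i) = - avg p f.
Proof.
rewrite /avg -mulNr -sumrN; congr (_ / _).
by apply: eq_bigr => i _; rewrite mulrN.
Qed.

Lemma le_avg p f g : (forall i, 0 < p i) -> (forall i, f i <= g i) ->
  avg p f <= avg p g.
Proof.
move=> p0 fg; apply: ler_wpM2r.
  by rewrite invr_ge0; apply: sumr_ge0 => i _; exact: ltW.
by apply: ler_sum => i _; rewrite ler_pM2l.
Qed.

Lemma avg_cst p c (i0 : I) : (forall i, 0 < p i) -> avg p (fun=> c) = c.
Proof.
move=> p0; rewrite /avg -mulr_suml mulrAC divff ?mul1r //.
by rewrite gt_eqF // (sum_weight_gt0 i0).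
Qed.

(** With [w] the mean of [f] under [q], the sum of [q (w - f)] vanishes, so the difference of means
    times the mass of [p] is the sum of [(p - q) (w - f)]. Here [w - f <= 1], since [f] ranges in an
    interval of length 1. *)
Lemma avg_damping p q f g (i0 : I) : (forall i, 0 < q i) ->
  (forall i, q i <= p i) -> (forall i, p i - q i <= p i * g i) ->
  (forall i, `|f i| <= 2^-1) ->
  avg q f - avg p f <= avg p g.
Proof.
move=> q0 qp pqg fle.
have p0 i : 0 < p i by exact: lt_le_trans (qp i).
have P0 := sum_weight_gt0 i0 p0; have Q0 := sum_weight_gt0 i0 q0.
have W : avg q f <= 2^-1.
  rewrite -(avg_cst 2^-1 i0 q0); apply: le_avg => // i.
  exact: le_trans (ler_norm _) (fle i).
set w := avg q f in W *.
have wq : \sum_i q i * (w - f i) = 0.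
  under eq_bigr do rewrite mulrBr.
  rewrite sumrB -mulr_suml /w /avg mulrCA divff ?gt_eqF // mulr1.
  by rewrite subrr.
rewrite /avg ler_pdivlMr // mulrBl divfK ?gt_eqF // mulr_sumr.
have <- : \sum_i (w * p i - p i * f i - q i * (w - f i)) =
    \sum_i w * p i - \sum_i p i * f i.
  by rewrite !sumrB wq subr0.
apply: ler_sum => i _; apply: le_trans (pqg i).
have -> : w * p i - p i * f i - q i * (w - f i) = (p i - q i) * (w - f i).
  by ring.
have := fle i; rewrite ler_norml => /andP[fi _].
by rewrite -[leRHS]mulr1 ler_wpM2l ?subr_ge0 //; lra.
Qed.

(** For [y <= x], factor out [expR (- (eta * x)) >= 1 - eta * x >= 1/2]; the other factor is [expR
    (eta * (x - y)) - 1 >= eta * (x - y)]. *)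
Lemma expR_antimonotone_gap eta x y : 0 < eta -> eta < 1 ->
  `|x| <= 2^-1 -> `|y| <= 2^-1 ->
  eta * (x - y) ^+ 2 / 2 <=
    (expR (- (eta * y)) - expR (- (eta * x))) * (x - y).
Proof.
move=> e0 e1.
wlog xy : x y / y <= x => [H hx hy|].
  have [/H|/ltW/H] := leP y x; first exact.
  move=> /(_ hy hx); congr (_ <= _); ring.
rewrite !ler_norml => /andP[x1 x2] /andP[y1 y2].
have -> : expR (- (eta * y)) = expR (- (eta * x)) * expR (eta * (x - y)).
  by rewrite -expRD; congr expR; ring.
have h1 := expR_ge1Dx (eta * (x - y)).
have h2 := expR_ge1Dx (- (eta * x)).
have h3 : 2^-1 <= expR (- (eta * x)) by nra.
have d0 : 0 <= eta * (x - y) by rewrite mulr_ge0 ?subr_ge0 // ltW.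
have h4 : 2^-1 * (eta * (x - y)) <=
    expR (- (eta * x)) * expR (eta * (x - y)) - expR (- (eta * x)).
  rewrite -[X in _ <= _ - X]mulr1 -mulrBr; apply: ler_pM => //; lra.
have := ler_wpM2r (_ : 0 <= x - y) h4; rewrite subr_ge0 => /(_ xy).
by apply: le_trans; rewrite le_eqVlt; apply/orP; left; apply/eqP; field.
Qed.

(** Chebyshev's argument: over the common denominator, the difference of means is a double sum
    which, once symmetrized, has only nonnegative terms. The denominator is at most
    [2 * #|I| ^ 2]. *)
Lemma avg_tilt_gain q f eta (i1 i2 : I) :
  0 < eta -> eta < 1 -> i1 != i2 ->
  (forall i, 0 < q i <= 1) -> q i1 = 1 -> q i2 = 1 ->
  (forall i, `|f i| <= 2^-1) ->
  eta * (f i1 - f i2) ^+ 2 / (4 * #|I|%:R ^+ 2) <=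
    avg q f - avg (fun i => q i * expR (- (eta * f i))) f.
Proof.
move=> e0 e1 i12 q01 q1 q2 fle.
have q0 i : 0 < q i by case/andP: (q01 i).
set r := fun i => q i * expR (- (eta * f i)).
have r0 i : 0 < r i by rewrite mulr_gt0 ?expR_gt0.
have Q0 := sum_weight_gt0 i1 q0; have R0 := sum_weight_gt0 i1 r0.
have r2 i : r i <= 2.
  have : expR (- (eta * f i)) <= 2.
    have := fle i; rewrite ler_norml => /andP[f1 f2].
    have h := expR_ge1Dx (eta * f i).
    have h2 : 2^-1 <= expR (eta * f i) by nra.
    by rewrite expRN -[leRHS]invrK lef_pV2 // posrE ?expR_gt0 ?invr_gt0.
  have /andP[_ qi] := q01 i.
  by move=> h; rewrite -[leRHS]mul1r ler_pM // ltW // expR_gt0.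
have Qle : \sum_i q i <= #|I|%:R.
  rewrite -sumr_const; apply: ler_sum => i _.
  by case/andP: (q01 i).
have Rle : \sum_i r i <= 2 * #|I|%:R.
  rewrite mulr_natr -sumr_const; apply: ler_sum => i _; exact: r2.
pose D i j := q i * r j * (f i - f j).
have DE : avg q f - avg r f =
    (\sum_i \sum_j D i j) / ((\sum_i q i) * \sum_i r i).
  have -> : \sum_i \sum_j D i j =
      (\sum_i q i * f i) * (\sum_i r i) - (\sum_i q i) * (\sum_i r i * f i).
    rewrite !mulr_suml -sumrB; apply: eq_bigr => i _.
    rewrite !mulr_sumr -sumrB; apply: eq_bigr => j _; rewrite /D; ring.
  by rewrite /avg; field; rewrite !gt_eqF.
pose E i j := q i * q j *
  ((expR (- (eta * f j)) - expR (- (eta * f i))) * (f i - f j)).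
(* Averaging [D i j] with [D j i] makes every term nonnegative. *)
have DsE : (\sum_i \sum_j D i j) *+ 2 = \sum_i \sum_j E i j.
  rewrite mulr2n {2}exchange_big -big_split /=; apply: eq_bigr => i _.
  rewrite -big_split /=; apply: eq_bigr => j _; rewrite /D /E /r; ring.
have Egap i j : q i * q j * (eta * (f i - f j) ^+ 2 / 2) <= E i j.
  by rewrite ler_pM2l ?mulr_gt0 //; exact: expR_antimonotone_gap.
have E0 i j : 0 <= E i j.
  apply: le_trans (Egap i j); apply: mulr_ge0; first by rewrite ltW ?mulr_gt0.
  by rewrite divr_ge0 // mulr_ge0 ?sqr_ge0 // ltW.
have sum2 (F : I -> R) : (forall i, 0 <= F i) -> F i1 + F i2 <= \sum_i F i.
  move=> F0; rewrite (bigD1 i1) //= (bigD1 i2) /=; last by rewrite eq_sym.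
  by rewrite addrA lerDl; exact: sumr_ge0.
(* Only the two ordered pairs made of [i1] and [i2] are kept, where both weights [q] equal 1. *)
have EE : E i1 i2 + E i2 i1 <= \sum_i \sum_j E i j.
  apply: le_trans (sum2 (fun i => \sum_j E i j) _) => [|i]; last exact: sumr_ge0.
  apply: lerD.
    by rewrite (bigD1 i2) //= lerDl; exact: sumr_ge0.
  by rewrite (bigD1 i1) //= lerDl; exact: sumr_ge0.
have S0 : eta * (f i1 - f i2) ^+ 2 / 2 <= \sum_i \sum_j D i j.
  have := Egap i1 i2; have := Egap i2 i1; rewrite q1 q2 !mul1r.
  have -> : (f i2 - f i1) ^+ 2 = (f i1 - f i2) ^+ 2 by ring.
  move: DsE EE; lra.
rewrite DE ler_pdivlMr ?mulr_gt0 //; apply: le_trans S0.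
have N0 : 0 < #|I|%:R :> R by apply: lt_le_trans Qle.
have QR : (\sum_i q i) * (\sum_i r i) <= #|I|%:R * (2 * #|I|%:R).
  by apply: ler_pM => //; exact: ltW.
apply: le_trans (ler_wpM2l _ QR) _.
  apply: divr_ge0; last by rewrite mulr_ge0 ?sqr_ge0.
  by apply: mulr_ge0; [exact: ltW | exact: sqr_ge0].
rewrite le_eqVlt; apply/orP; left; apply/eqP; field.
by rewrite gt_eqF.
Qed.

Lemma avg_two_round_gain p f g eta v (i1 i2 : I) :
  0 < eta -> eta < 1 -> i1 != i2 ->
  (forall i, 0 < p i <= 1) -> p i1 = 1 -> p i2 = 1 ->
  (forall i, v <= f i) -> f i1 = v -> f i2 = v ->
  (forall i, `|g i| <= 2^-1) ->
  2 * v + eta * (g i1 - g i2) ^+ 2 / (4 * #|I|%:R ^+ 2) <=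
    avg p (f \+ g) +
    avg (fun i => p i * expR (- (eta * (f i - v + g i))))
      (fun i => f i - g i).
Proof.
move=> e0 e1 i12 p01 p1 p2 vf f1 f2 gle.
have p0 i : 0 < p i by case/andP: (p01 i).
pose q i := p i * expR (- (eta * (f i - v))).
have q0 i : 0 < q i by rewrite mulr_gt0 ?expR_gt0.
have qp i : q i <= p i.
  rewrite -[leRHS]mulr1 ler_pM2l // -expR0 ler_expR oppr_le0.
  by rewrite mulr_ge0 ?subr_ge0 // ltW.
have q01 i : 0 < q i <= 1.
  by rewrite q0; apply: le_trans (qp i) _; case/andP: (p01 i).
have q1 : q i1 = 1 by rewrite /q p1 f1 subrr mulr0 oppr0 expR0 mulr1.
have q2 : q i2 = 1 by rewrite /q p2 f2 subrr mulr0 oppr0 expR0 mulr1.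
(* From [1 - expR (- s) <= s] with [s = eta * (f i - v)], and [eta < 1]. *)
have pq i : p i - q i <= p i * (f i - v).
  rewrite /q -[X in X - _]mulr1 -mulrBr ler_pM2l //.
  have h := expR_ge1Dx (- (eta * (f i - v))).
  by have := vf i; nra.
have damp := avg_damping i1 q0 qp pq gle.
have tilt := avg_tilt_gain e0 e1 i12 q01 q1 q2 gle.
have -> : avg (fun i => p i * expR (- (eta * (f i - v + g i))))
      (fun i => f i - g i) =
    avg (fun i => q i * expR (- (eta * g i))) (f \+ (fun i => - g i)).
  apply: eq_avg => // i; rewrite /q -mulrA -expRD; congr (_ * expR _); ring.
set r := fun i => q i * expR _ in tilt *.
have r0 i : 0 < r i by rewrite mulr_gt0 ?expR_gt0.
(* The surplus [avg p f - v] of the first round is spent on [damp]; from [f] the second round needs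
   only [v]. *)
have vr : v <= avg r f by rewrite -{1}(avg_cst v i1 r0); exact: le_avg.
have pf : avg p (fun i => f i - v) = avg p f - v.
  by rewrite (avgD p f (fun=> - v)) (avg_cst (- v) i1 p0).
rewrite !avgD avgN; rewrite pf in damp; lra.
Qed.

End WeightedMean.

(** * Linearity of the payoff, and perturbations that stay in the simplex *)

Section Payoff.
Context {R : realType} {n m : nat} (A : 'M[R]_(n, m)).
Implicit Types (x d : 'cV[R]_n) (y : 'cV[R]_m).

Lemma payoffE x y :
  payoff A x y = \sum_i y i 0 * payoff A x (pure R i).
Proof.
rewrite /payoff mxE; apply: eq_bigr => i _; rewrite mulrC; congr (_ * _).
by rewrite /pure -colE [RHS]mxE.
Qed.

Lemma payoffDl x d y : payoff A (x + d) y = payoff A x y + payoff A d y.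
Proof. by rewrite /payoff linearD /= !mulmxDl mxE. Qed.

Lemma payoffZl c x y : payoff A (c *: x) y = c * payoff A x y.
Proof. by rewrite /payoff linearZ /= -!scalemxAl mxE. Qed.

Lemma payoffBl x d y : payoff A (x - d) y = payoff A x y - payoff A d y.
Proof. by rewrite -scaleN1r payoffDl payoffZl mulN1r. Qed.

Lemma payoff_mwu eta (x : nat -> 'cV[R]_n) t d :
  payoff A d (mwu A eta x t) =
    avg (mwu_weight A eta x t) (fun i => payoff A d (pure R i)).
Proof.
rewrite payoffE /avg mulr_suml; apply: eq_bigr => i _.
by rewrite mxE mulrAC.
Qed.

Lemma minmax_BR_payoff x i : minmax_strategy A x -> BR A x i ->
  payoff A x (pure R i) = Val A.
Proof.
move=> [_ <-] bri; apply/eqP; rewrite eq_le; apply/andP; split.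
  by apply: lb_le_inf => [|_ [j _ <-]]; [exists (payoff A x (pure R i)), i|].
apply: ge_inf; last by exists i.
by exists (payoff A x (pure R i)) => _ [j _ <-].
Qed.

Lemma simplexD_toward_pure x c k : simplex R n x -> 0 <= c <= 1 ->
  simplex R n (x + c *: (pure R k - x)).
Proof.
move=> [x0 x1] /andP[c0 c1]; split => [i|].
  rewrite !mxE; have := x0 i; case: (_ && _) => /= ?; nra.
under eq_bigr do rewrite !mxE.
rewrite big_split /= x1 -mulr_sumr sumrB x1 (bigD1 k) //= eqxx.
by rewrite big1 ?addr0 ?subrr ?mulr0 ?addr0 // => i /negbTE ->.
Qed.

(** Moving away from [a_k] scales every other coordinate by [1 + c]; coordinate [k] becomes
    [x_k - c (1 - x_k)], at least [x_k - c]. *)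
Lemma simplexB_toward_pure x c k : simplex R n x -> 0 <= c <= x k 0 ->
  simplex R n (x - c *: (pure R k - x)).
Proof.
move=> [x0 x1] /andP[c0 c1]; split => [i|].
  rewrite !mxE andbT; have := x0 i.
  by case: eqP => [->|_] /= ?; nra.
under eq_bigr do rewrite !mxE.
rewrite sumrB x1 -mulr_sumr sumrB x1 (bigD1 k) //= eqxx.
by rewrite big1 ?addr0 ?subrr ?mulr0 ?subr0 // => i /negbTE ->.
Qed.

End Payoff.

(* In the last round of an odd horizon [x] secures [v] whatever the learner
   plays, whereas [x + d] could lose. *)
Definition alternating (R : realType) (n : nat) (x d : 'cV[R]_n) (T t : nat) :
    'cV[R]_n :=
  if ~~ odd t then x - d else if t == T then x else x + d.

Lemma sum_nat_half (R : realType) (F : nat -> R) T :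
  \sum_(1 <= t < T.+1) F t =
    \sum_(1 <= t < T./2.*2.+1) F t + (if odd T then F T else 0).
Proof.
have := odd_double_half T; case: ifP => _; rewrite ?add1n ?add0n => TE.
  by rewrite -{1}TE big_nat_recr //= TE.
by rewrite -{1}TE addr0.
Qed.

(** * Utility of the alternating play against MWU *)

Section Alternating.
Context {R : realType} {n m : nat} (A : 'M[R]_(n, m)).
Context (x d : 'cV[R]_n) (v eta : R) (T : nat) (i1 i2 : 'I_m).
Local Notation play := (alternating x d T).
Local Notation u := (fun i => payoff A x (pure R i)).
Local Notation w := (fun i => payoff A d (pure R i)).
Context (e0 : 0 < eta) (e1 : eta < 1) (i12 : i1 != i2).
Context (u1 : u i1 = v) (u2 : u i2 = v) (vu : forall i, v <= u i).
Context (wle : forall i, `|w i| <= 2^-1).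
Local Notation gain := (eta * (w i1 - w i2) ^+ 2 / (4 * m%:R ^+ 2)).

Lemma alternating_odd j : (j.*2.+2 <= T)%N -> play j.*2.+1 = x + d.
Proof. by move=> jT; rewrite /alternating /= odd_double ltn_eqF. Qed.

Lemma alternating_even j : play j.*2.+2 = x - d.
Proof. by rewrite /alternating /= odd_double. Qed.

(** The perturbations [d] and [- d] cancel within each completed pair. *)
Lemma alternating_history j i : (j.*2 <= T)%N ->
  \sum_(1 <= s < j.*2.+1) payoff A (play s) (pure R i) = j.*2%:R * u i.
Proof.
elim: j => [|j IHj] jT; first by rewrite big_geq // mul0r.
rewrite doubleS in jT *.
rewrite big_nat_recr //= big_nat_recr //= IHj; last by lia.
rewrite alternating_odd // alternating_even payoffDl payoffBl.
by rewrite -addn2 natrD; ring.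
Qed.

Lemma alternating_two_round_gain j : (j.*2.+2 <= T)%N ->
  2 * v + gain <=
    payoff A (play j.*2.+1) (mwu A eta play j.*2.+1) +
    payoff A (play j.*2.+2) (mwu A eta play j.*2.+2).
Proof.
move=> jT.
(* MWU weights before the pair, rescaled by a common factor so that best responses have weight 1. *)
pose p i := expR (- (eta * (j.*2%:R * (u i - v)))).
have p01 i : 0 < p i <= 1.
  rewrite expR_gt0 -expR0 ler_expR oppr_le0 mulr_ge0 ?(ltW e0) //.
  by rewrite mulr_ge0 // subr_ge0.
have p1 : p i1 = 1 by rewrite /p u1 subrr !mulr0 oppr0 expR0.
have p2 : p i2 = 1 by rewrite /p u2 subrr !mulr0 oppr0 expR0.
have := avg_two_round_gain e0 e1 i12 p01 p1 p2 vu u1 u2 wle.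
rewrite card_ord => /le_trans; apply; rewrite !payoff_mwu.
rewrite alternating_odd // alternating_even le_eqVlt; apply/orP; left.
apply/eqP; congr (_ + _).
  rewrite -(@avgZ _ _ p _ (expR (- (eta * (j.*2%:R * v))))) ?gt_eqF ?expR_gt0 //.
  apply: eq_avg => i /=; last by rewrite payoffDl.
  rewrite /mwu_weight alternating_history; last by lia.
  by rewrite /p -expRD; congr expR; ring.
(* One more round has been observed, hence one more factor [expR (- (eta * v))] than for the first
   round. *)
rewrite -(@avgZ _ _ _ _ (expR (- (eta * (j.*2.+1%:R * v))))) ?gt_eqF ?expR_gt0 //.
apply: eq_avg => i /=; last by rewrite payoffBl.
rewrite /mwu_weight big_nat_recr //= alternating_history; last by lia.
rewrite alternating_odd // payoffDl /p -!expRD; congr expR.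
by rewrite -natr1; ring.
Qed.

(** Each of the [T./2] pairs earns [gain] above [2 * v]; an unpaired last round contributes at least
    [v]. *)
Lemma alternating_utility :
  T%:R * v + T./2%:R * gain <= total_utility A eta play T.
Proof.
have pairs K : (K.*2 <= T)%N ->
    K.*2%:R * v + K%:R * gain <=
    \sum_(1 <= t < K.*2.+1) payoff A (play t) (mwu A eta play t).
  elim: K => [|K IHK] KT; first by rewrite big_geq // !mul0r addr0.
  rewrite doubleS in KT *.
  rewrite big_nat_recr //= big_nat_recr //=.
  have := alternating_two_round_gain KT; have := IHK ltac:(lia).
  rewrite -[K.+1]addn1 -[K.*2.+2]addn2 !natrD; lra.
have pT := pairs T./2 ltac:(lia).
have TE : T%:R = (odd T)%:R + T./2.*2%:R :> R.
  by rewrite -natrD odd_double_half.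
rewrite /total_utility sum_nat_half TE.
case: ifP => oT; last by rewrite addr0 add0r.
have vT : v <= payoff A (play T) (mwu A eta play T).
  have p0 i : 0 < mwu_weight A eta play T i by exact: expR_gt0.
  have -> : play T = x by rewrite /alternating oT eqxx.
  by rewrite payoff_mwu -(avg_cst v i1 p0); exact: le_avg.
by rewrite mulrDl mul1r; lra.
Qed.

End Alternating.

(** * Choice of the perturbation and of the constant *)

Theorem proposition4 (R : realType) (n m : nat) (A : 'M[R]_(n, m))
    (hA : non_coinciding_best_responses A) :
  exists C : R, 0 < C /\
    forall (eta : R) (T : nat), 0 < eta -> eta < 1 -> T <> 1%N ->
      exists x : nat -> 'cV[R]_n,
        (forall t : nat, (1 <= t <= T)%N -> simplex R n (x t)) /\
        T%:R * Val A + C * eta * T%:R <= total_utility A eta x T.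
Proof.
have [x [mx [i1 [i2 [b1 [b2 [k [xk Ak]]]]]]]] := hA.
have [sx _] := mx.
have u1 := minmax_BR_payoff mx b1; have u2 := minmax_BR_payoff mx b2.
have vu i : Val A <= payoff A x (pure R i) by rewrite -u1.
pose g i := payoff A (pure R k - x) (pure R i).
have gE i : g i = payoff A (pure R k) (pure R i) - payoff A x (pure R i).
  exact: payoffBl.
(* Both best responses give [x] the same payoff, so the difference is that of the payoffs of
   [a_k]. *)
have g12 : g i1 - g i2 != 0.
  by rewrite !gE u1 u2; apply/eqP => h; apply: Ak; lra.
have i12 : i1 != i2 by apply: contraNneq g12 => ->; rewrite subrr.
pose M := \sum_i `|g i|.
have M0 : 0 <= M by exact: sumr_ge0.
have gM i : `|g i| <= M by rewrite /M (bigD1 i) //= lerDl; exact: sumr_ge0.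
have xk1 : x k 0 <= 1.
  by case: sx => x0 <-; rewrite (bigD1 k) //= lerDl; exact: sumr_ge0.
(* Small enough for [c <= x k 0], which keeps [x - d] in the simplex, and for [c * M <= 1/2], which
   bounds the perturbed payoffs. *)
pose c := x k 0 / (2 * (1 + M)).
have M1 : 0 < 2 * (1 + M) by lra.
have c0 : 0 < c by exact: divr_gt0.
have cM : c * (2 * (1 + M)) = x k 0 by rewrite divfK // gt_eqF.
have cxk : c <= x k 0 by rewrite -cM; nra.
pose d := c *: (pure R k - x).
have wE i : payoff A d (pure R i) = c * g i by rewrite payoffZl.
have wle i : `|payoff A d (pure R i)| <= 2^-1.
  rewrite wE normrM (gtr0_norm c0); have := gM i; have := normr_ge0 (g i); nra.
have m0 : 0 < m%:R :> R by rewrite ltr0n; apply: leq_ltn_trans (ltn_ord i1).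
(* The 12 is the 4 of the gain per pair times the 3 of [T <= 3 * T./2]. *)
exists ((c * (g i1 - g i2)) ^+ 2 / (12 * m%:R ^+ 2)); split.
  apply: divr_gt0; last by rewrite mulr_gt0 ?exprn_gt0.
  by rewrite exprn_even_gt0 //= mulf_neq0 // gt_eqF.
move=> eta T e0 e1 T1; exists (alternating x d T); split=> [t _|].
  rewrite /alternating; case: ifP => _; last case: ifP => _ //.
    by apply: simplexB_toward_pure; rewrite // (ltW c0).
  by apply: simplexD_toward_pure; rewrite // (ltW c0) (le_trans cxk).
apply: le_trans (alternating_utility T e0 e1 i12 u1 u2 vu wle).
rewrite lerD2l !wE -mulrBr.
(* This fails only for [T = 1], where there is no complete pair; [T = 3] gives equality. *)
have T3 : T%:R <= 3 * T./2%:R :> R by rewrite -natrM ler_nat; lia.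
have h : 0 <= eta * (c * (g i1 - g i2)) ^+ 2 / (12 * m%:R ^+ 2).
  apply: divr_ge0; last by rewrite mulr_ge0 ?sqr_ge0.
  by apply: mulr_ge0; [exact: ltW | exact: sqr_ge0].
apply: le_trans (_ : eta * (c * (g i1 - g i2)) ^+ 2 / (12 * m%:R ^+ 2) *
  (3 * T./2%:R) <= _).
  apply: le_trans (ler_wpM2l h T3).
  by rewrite le_eqVlt; apply/orP; left; apply/eqP; ring.
by rewrite le_eqVlt; apply/orP; left; apply/eqP; field; rewrite gt_eqF.
Qed.
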